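(* Let $Y$ be a Banach space, let $F(\cdot):\mathbb{R}\rightsquigarrow Y$ be a set valued map whose graph $\mathrm{gr}\,F(\cdot)\subset \mathbb{R}\times Y$ is a closed set, and let $(x,y)\in \mathrm{gr}\,F(\cdot)$. Then for each $p\in\mathbb{R}\setminus\{0\}$ the equality $$\frac{\partial^{U}F(x,y)}{\partial p}=D^{U}F(x,y)|(p)$$ holds.
   Context: For Banach spaces $X,Y$, a set valued map $F(\cdot):X\rightsquigarrow Y$ assigns to each $x\in X$ a subset $F(x)\subset Y$. Its graph is $\mathrm{gr}\,F(\cdot)=\{(x,y)\in X\times Y: y\in F(x)\}$. Here $X=\mathbb{R}$. The product $X\times Y$ is a Banach space with any of the usual equivalent product norms. For a subset $K$ of a Banach space and a point $z$ of that space, $d(z,K)=\inf_{k\in K}\|z-k\|$ is the distance from $z$ to $K$, with the convention $d(z,\emptyset)=+\infty$. Upper contingent cone: for a closed set $K$ in a Banach space $Z$ and $z\in Z$, $$T^{U}_{K}(z)=\left\{u\in Z:\liminf_{\delta\to 0^{+}}\frac{1}{\delta}d(z+\delta u,K)=0\right\}.$$ Upper differential: $D^{U}F(x,y)|(\cdot):X\rightsquigarrow Y$ is the set valued map whose graph is $T^{U}_{\mathrm{gr}\,F(\cdot)}(x,y)$, i.e. for $p\in X$ and $v\in Y$, $v\in D^{U}F(x,y)|(p)$ if and only if $(p,v)\in T^{U}_{\mathrm{gr}\,F(\cdot)}(x,y)$. Upper derivative set of $F(\cdot)$ at $(x,y)$ in the direction $p\in X$: $$\frac{\partial^{U}F(x,y)}{\partial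 p}=\left\{u\in Y:\liminf_{\delta\to 0^{+}}\frac{1}{\delta}d\big(y+\delta u,F(x+\delta p)\big)=0\right\}.$$ *)

(* Defs.v *)
From HB Require Import structures.
From mathcomp Require Import all_boot all_order all_algebra.
From mathcomp Require Import all_classical all_reals all_analysis.

Set Implicit Arguments.
Unset Strict Implicit.
Unset Printing Implicit Defensive.

Import Order.TTheory GRing.Theory Num.Theory.
Import numFieldNormedType.Exports.

Local Open Scope classical_set_scope.
Local Open Scope ring_scope.

(* The infimum is taken in the extended reals, so that dist z set0 = +oo. *)
Definition dist (R : realType) (Z : normedModType R) (z : Z) (K : set Z) :
    \bar R :=
  ereal_inf [set `|z - k|%:E | k in K].

Definition upper_contingent_cone (R : realType) (Z : normedModType R)
    (K : set Z) (z : Z) : set Z :=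
  [set u : Z |
    limf_einf (fun delta : R => (delta^-1)%:E * dist (z + delta *: u)%R K)%E
              0^'+ = 0%E].

Definition graph_of (X Y : Type) (F : X -> set Y) : set (X * Y) :=
  [set xy | F xy.1 xy.2].

(* The product X * Y carries the maximum norm. *)
Definition upper_differential (R : realType) (X Y : normedModType R)
    (F : X -> set Y) (x : X) (y : Y) : X -> set Y :=
  fun p => [set v | upper_contingent_cone (graph_of F) (x, y) (p, v)].

Definition upper_derivative_set (R : realType) (X Y : normedModType R)
    (F : X -> set Y) (x : X) (y : Y) (p : X) : set Y :=
  [set u : Y |
    limf_einf
      (fun delta : R =>
         (delta^-1)%:E * dist (y + delta *: u)%R (F (x + delta *: p)%R))%E
      0^'+ = 0%E].

Lemma dist_set0 (R : realType) (Z : normedModType R) (z : Z) :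
  dist z set0 = +oo%E.
Proof. by rewrite /dist image_set0 ereal_inf0. Qed.

(* Main.v *)
Require Import Defs.
From HB Require Import structures.
From mathcomp Require Import all_boot all_order all_algebra.
From mathcomp Require Import all_classical all_reals all_analysis.
From mathcomp Require Import ring lra.
Import Order.TTheory GRing.Theory Num.Theory.
Import numFieldNormedType.Exports.
Local Open Scope classical_set_scope.
Local Open Scope ring_scope.

(** Both sides are lower limits, as the step [d] tends to [0] from the right,
    of a distance divided by [d]. Such a limit vanishes exactly when, for every
    [e > 0], some step [d < e] admits a point of the set within [e * d] of the
    moving target ([limf_einf_distP]). This turns the theorem into a comparison
    of two approximation properties:

    - for the derivative set, a point [k] of [F (x + d * p)] with
      [`|y + d *: v - k| < e * d];
    - for the differential, a point [(s, k)] of the graph with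
      [`|x + d * p - s| < e * d] and [`|y + d *: v - k| < e * d].

    The first property gives the second by taking [s = x + d * p]. Conversely,
    the domain being one-dimensional and [p] non-zero, any abscissa [s] lies on
    the line through [x] directed by [p]: it is [x + d' * p] with
    [d' = (s - x) / p], and [d'] differs from [d] by at most a small multiple
    of [d]. Replacing the step [d] by [d'] therefore makes the abscissa exact
    and costs only a constant factor, depending on [v] and [p], in the
    tolerance ([graph_step]). *)

(** A non-negative extended-real function has lower limit zero at the right of
    the origin exactly when it takes arbitrarily small values arbitrarily close
    to the origin; one tolerance can serve for both, since shrinking it only
    strengthens the two requirements. *)
Lemma limf_einf_right0_eq0P (R : realType) (f : R -> \bar R) :
  (forall d, 0 < d -> (0 <= f d)%E) ->
  limf_einf f 0^'+ = 0%E <->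
  forall e : R, 0 < e -> exists2 d : R, 0 < d < e & (f d < e%:E)%E.
Proof.
move=> f_ge0; rewrite limf_einfE; split=> [liminf0 e e_gt0|small].
  have V0 : 0^'+ [set d : R | 0 < d < e].
    near=> d; apply/andP; split; near: d;
      [exact: nbhs_right_gt | exact: nbhs_right_lt].
  have : (ereal_inf (f @` [set d : R | (0 < d < e)%R]) < e%:E)%E.
    apply: (@le_lt_trans _ _ 0%E); last by rewrite lte_fin.
    rewrite -liminf0; apply: ereal_sup_ubound.
    by exists [set d : R | 0 < d < e].
  by case/ereal_inf_lt => _ [d d_e <-] fd_e; exists d.
apply/eqP; rewrite eq_le; apply/andP; split.
  apply: ge_ereal_sup => _ [V [r /= r_gt0 rV] <-].
  apply/lee_addgt0Pr => e e_gt0; rewrite add0e.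
  have [|d /andP[d_gt0]] := small (Num.min e r); first by rewrite lt_min e_gt0.
  rewrite lt_min => /andP[d_e d_r] fd_lt.
  apply: ge_ereal_inf; exists (f d).
    exists d => //; apply: rV => //=.
    by rewrite sub0r normrN gtr0_norm.
  apply: le_trans (ltW fd_lt) _.
  by rewrite lee_fin ge_min lexx.
apply: le_ereal_sup_tmp; exists (ereal_inf (f @` [set d : R | 0 < d])).
  by exists [set d : R | 0 < d] => //; exact: nbhs_right_gt.
by apply: le_ereal_inf_tmp => _ [d d_gt0 <-]; exact: f_ge0.
Unshelve. all: by end_near.
Qed.

Lemma dist_ge0 (R : realType) (Z : normedModType R) (z : Z) (K : set Z) :
  (0 <= dist z K)%E.
Proof. by apply: le_ereal_inf_tmp => _ [k _ <-]; rewrite lee_fin. Qed.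

Lemma dist_ltP (R : realType) (Z : normedModType R) (z : Z) (K : set Z)
    (c : R) :
  (dist z K < c%:E)%E <-> exists2 k, K k & `|z - k| < c.
Proof.
split=> [/ereal_inf_lt[_ [k Kk <-]]|[k Kk zk]].
  by rewrite lte_fin => zk; exists k.
apply: (@le_lt_trans _ _ `|z - k|%:E); last by rewrite lte_fin.
by apply: ereal_inf_lbound; exists k.
Qed.

(** Both tangency notions are lower limits of a distance divided by the step;
    letting the set vary with the step covers the two of them at once. *)
Lemma limf_einf_distP (R : realType) (Z : normedModType R) (a : R -> Z)
    (K : R -> set Z) :
  limf_einf (fun d : R => (d^-1)%:E * dist (a d) (K d))%E 0^'+ = 0%E <->
  forall e : R, 0 < e ->
    exists2 d : R, 0 < d < e & exists2 k, K d k & `|a d - k| < e * d.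
Proof.
have quot_lt (d e : R) : 0 < d ->
    ((d^-1)%:E * dist (a d) (K d) < e%:E)%E <->
    exists2 k, K d k & `|a d - k| < e * d.
  move=> d_gt0; rewrite muleC lte_pdivrMr// -EFinM; exact: dist_ltP.
rewrite limf_einf_right0_eq0P; last first.
  by move=> d d_gt0; rewrite mule_ge0 ?dist_ge0// lee_fin invr_ge0 ltW.
split=> small e /small[d d_e h]; exists d => //.
  by apply/quot_lt => //; case/andP: d_e.
by apply/quot_lt => //; case/andP: d_e.
Qed.

(** A point of the graph close to [(x + d *: p, y + d *: v)] sits above an
    abscissa [s] near [x + d * p]. As [p != 0], this abscissa is itself of the
    form [x + d' * p], and [d'] differs from [d] by less than [e * d / `|p|]:
    it is still positive and comparable to [d], and using it as the step moves
    the target [y + d *: v] only by a multiple of [e * d]. *)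
Lemma graph_step {R : realType} {Y : normedModType R} {x p s d e : R}
    {y v k : Y} :
  p != 0 -> 0 < d -> e <= `|p| / 2 ->
  `|x + d * p - s| < e * d -> `|y + d *: v - k| < e * d ->
  let d' := (s - x) / p in
  [/\ s = x + d' * p, 0 < d', d' < 2 * d &
      `|y + d' *: v - k| < 2 * e * (`|v| / `|p| + 1) * d'].
Proof.
move=> p0 d_gt0 e_p xs yk d'.
have p_gt0 : 0 < `|p| by rewrite normr_gt0.
have sE : s = x + d' * p by rewrite /d'; field.
have dd' : `|d' - d| < e * d / `|p|.
  rewrite ltr_pdivlMr// -normrM; apply: le_lt_trans xs.
  by rewrite -normrN sE le_eqVlt; apply/orP; left; apply/eqP; congr `|_|; ring.
have half : e * d / `|p| <= d / 2.
  by rewrite ler_pdivrMr//; have := ler_wpM2r (ltW d_gt0) e_p; lra.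
have e_gt0 : 0 < e by rewrite -(pmulr_lgt0 _ d_gt0) (le_lt_trans _ yk).
have /andP[d'_lo d'_hi] : d / 2 < d' < 2 * d.
  by have := lt_le_trans dd' half; rewrite ltr_norml => /andP[]; lra.
split=> //; first by lra.
have -> : y + d' *: v - k = (d' - d) *: v + (y + d *: v - k).
  by rewrite scalerBl !addrA [in RHS](addrC _ y) !addrA addrNK.
apply: le_lt_trans (ler_normD _ _) _; rewrite normrZ.
have drift : `|d' - d| * `|v| <= e * d / `|p| * `|v|.
  exact: ler_wpM2r (ltW dd').
have -> : 2 * e * (`|v| / `|p| + 1) * d' = e * (`|v| / `|p| + 1) * (2 * d').
  by ring.
have : e * (`|v| / `|p| + 1) * d < e * (`|v| / `|p| + 1) * (2 * d').
  rewrite ltr_pM2l; first by lra.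
  by rewrite mulr_gt0// ltr_wpDl// divr_ge0.
have -> : e * (`|v| / `|p| + 1) * d = e * d / `|p| * `|v| + e * d by ring.
lra.
Qed.

Theorem theorem3p1 (R : realType) (Y : completeNormedModType R)
    (F : R -> set Y) (x : R) (y : Y) :
  closed (graph_of F) ->
  graph_of F (x, y) ->
  forall p : R, p != 0 ->
    upper_derivative_set F x y p = upper_differential F x y p.
Proof.
move=> _ _ p p0; apply/seteqP; split=> v.
  move=> /limf_einf_distP small; apply/limf_einf_distP => e e_gt0.
  have [d d_e [k Fk yk]] := small e e_gt0; exists d => //.
  exists (x + d * p, k) => //.
  rewrite prod_normE /= subrr normr0 gt_max yk andbT.
  by rewrite mulr_gt0//; case/andP: d_e.
move=> /limf_einf_distP small; apply/limf_einf_distP => e e_gt0.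
have p_gt0 : 0 < `|p| by rewrite normr_gt0.
set c := `|v| / `|p| + 1.
have c_gt0 : 0 < c by rewrite ltr_wpDl// divr_ge0.
(* [graph_step] multiplies the bound on the step by 2 and the bound on the
   distance quotient by [2 * c]; the first constraint is what it assumes. *)
have [|d] := small (Num.min (`|p| / 2) (Num.min (e / 2) (e / (2 * c)))).
  by rewrite !lt_min !divr_gt0// mulr_gt0.
set m := Num.min _ _ => /andP[d_gt0 d_m] [[s k] Fsk].
rewrite prod_normE /= gt_max => /andP[xs yk].
have /and3P[m_p m_e m_c] : [&& m <= `|p| / 2, m <= e / 2 & m <= e / (2 * c)].
  by rewrite -!le_min.
have [sE d'_gt0 d'_lt yk'] := graph_step p0 d_gt0 m_p xs yk.
exists ((s - x) / p).
  by rewrite d'_gt0 /=; lra.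
exists k; first by rewrite /= -[_ *: p]/(_ * p) -sE.
apply: lt_le_trans yk' _; apply: ler_wpM2r; first exact: ltW.
by move: m_c; rewrite ler_pdivlMr ?mulr_gt0//; rewrite -/c; lra.
Qed.
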